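(* Each of the following sets of semigroup varieties is definable: the set of all completely regular varieties; the set of all completely simple varieties; the set of all periodic group varieties; the set of all combinatorial varieties; the set of all varieties of idempotent semigroups; the set of all nil-varieties.
   Context: $\mathbf{SEM}$ denotes the lattice of all semigroup varieties, ordered by inclusion, with join $\vee$ and meet $\wedge$. A subset $A$ of a lattice $\langle L;\vee,\wedge\rangle$ is called definable in $L$ if there is a first-order formula $\Phi(x)$ with one free variable $x$ (and no parameters) in the language of the lattice operations $\vee$ and $\wedge$ such that, for every $a\in L$, the sentence $\Phi(a)$ is true in $L$ if and only if $a\in A$. A set of semigroup varieties is called definable if it is definable in $\mathbf{SEM}$. An adjective indicating a property shared by all semigroups of a variety is applied to the variety itself: a variety is completely regular if all its members are completely regular semigroups (unions of groups), completely simple if all its members are completely simple semigroups, a periodic group variety if all its members are periodic groups (considered as semigroups), combinatorial if all subgroups of its members are trivial, and a nil-variety if all its members are nilsemigroups (semigroups with zero in which every element has a power equal to zero). *)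

(* Defs.v *)
From HB Require Import structures.
From mathcomp Require Import all_boot all_order.
From mathcomp Require Import boolp classical_sets.

Set Implicit Arguments.
Unset Strict Implicit.
Unset Printing Implicit Defensive.

Local Open Scope classical_set_scope.
Local Open Scope group_scope.

(* Semigroup.type lives in too large a universe: a type of classes of its
   inhabitants cannot carry eqType, choiceType and latticeType structures.  Each
   semigroup below still is a semigroupType through the instances that follow.
   A semigroup is required to be nonempty. *)
Record semigroup := MkSemigroup {
  carrier :> Type;
  semigroup_op : carrier -> carrier -> carrier;
  semigroup_opA : associative semigroup_op;
  semigroup_inhabited : inhabited carrier
}.

HB.instance Definition _ (S : semigroup) := gen_eqMixin (carrier S).
HB.instance Definition _ (S : semigroup) := gen_choiceMixin (carrier S).
HB.instance Definition _ (S : semigroup) :=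
  isSemigroup.Build (carrier S) (@semigroup_opA S).

Section SemigroupProperties.
Variable S : semigroup.
Implicit Types (x y e : S) (G I : set S).

(* power x n is x ^ (n + 1). *)
Definition power x (n : nat) : S := iter n (mul x) x.

Definition is_identity_of G e :=
  G e /\ forall x, G x -> e * x = x /\ x * e = x.

Definition is_subgroup G :=
  (forall x y, G x -> G y -> G (x * y)) /\
  exists2 e, is_identity_of G e &
    forall x, G x -> exists2 y, G y & x * y = e /\ y * x = e.

Definition completely_regular := forall x, exists2 G, is_subgroup G & G x.

Definition is_ideal I :=
  I !=set0 /\ forall x y, I x -> I (x * y) /\ I (y * x).

Definition simple_semigroup := forall I, is_ideal I -> I = setT.

Definition idempotent_elt e := e * e = e.

(* Primitivity in the sense of semigroups without zero: minimality among all
   idempotents for the order f <= e iff e f = f e = f. *)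
Definition primitive_idempotent e :=
  idempotent_elt e /\
  forall f : S, idempotent_elt f -> e * f = f -> f * e = f -> f = e.

Definition completely_simple :=
  simple_semigroup /\ exists e, primitive_idempotent e.

Definition periodic_group :=
  is_subgroup setT /\
  exists2 e, is_identity_of setT e & forall x, exists n, power x n = e.

Definition combinatorial :=
  forall G, is_subgroup G -> forall x y, G x -> G y -> x = y.

Definition idempotent_semigroup := forall x, idempotent_elt x.

Definition is_zero z := forall x : S, z * x = z /\ x * z = z.

Definition nilsemigroup :=
  exists2 z, is_zero z & forall x, exists n, power x n = z.

End SemigroupProperties.

(* Elements of the free semigroup over a countable alphabet:
   (i, [:: j; ..; k]) encodes the nonempty word x_i x_j .. x_k. *)
Definition word : Type := nat * seq nat.

Definition eval_word (S : semigroup) (f : nat -> S) (w : word) : S :=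
  foldl (fun a i => a * f i) (f w.1) w.2.

Definition identity : Type := word * word.

Definition satisfies (S : semigroup) (i : identity) :=
  forall f : nat -> S, eval_word f i.1 = eval_word f i.2.

Definition models (Sigma : set identity) : set semigroup :=
  [set S | forall i, Sigma i -> satisfies S i].

Definition identities_of (K : set semigroup) : set identity :=
  [set i | forall S, K S -> satisfies S i].

Record variety := MkVariety {
  members :> set semigroup;
  variety_equational : exists Sigma, members = models Sigma
}.

Lemma variety_eq (V W : variety) : members V = members W -> V = W.
Proof.
case: V W => [V pV] [W pW] /= VW; move: pV pW; rewrite VW => pV pW.
by rewrite (Prop_irrelevance pV pW).
Qed.

HB.instance Definition _ := gen_eqMixin variety.
HB.instance Definition _ := gen_choiceMixin variety.

Definition variety_le (V W : variety) : bool := `[< V `<=` W >].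

Fact variety_le_refl : reflexive variety_le.
Proof. by move=> V; apply/asboolP. Qed.

Fact variety_le_anti : antisymmetric variety_le.
Proof.
move=> V W /andP[/asboolP VW /asboolP WV].
by apply: variety_eq; apply/seteqP; split.
Qed.

Fact variety_le_trans : transitive variety_le.
Proof.
by move=> W V U /asboolP VW /asboolP WU; apply/asboolP/(subset_trans VW).
Qed.

Fact sem_display : Order.disp_t. Proof. exact: Order.Disp tt tt. Qed.

HB.instance Definition _ := Order.Le_isPOrder.Build sem_display variety
  variety_le_refl variety_le_anti variety_le_trans.

Fact variety_meet_equational (V W : variety) :
  exists Sigma, V `&` W = models Sigma.
Proof.
have [[s ->] [t ->]] := (variety_equational V, variety_equational W).
exists (s `|` t).
apply/seteqP; split=> [S [sS tS] i [/sS|/tS] //|S stS].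
by split=> i si; apply: stS; [left|right].
Qed.

Definition variety_meet (V W : variety) : variety :=
  MkVariety (variety_meet_equational V W).

Definition variety_join (V W : variety) : variety :=
  MkVariety (ex_intro (fun Sigma => models _ = models Sigma)
               (identities_of V `&` identities_of W) erefl).

Fact variety_meetP (U V W : variety) :
  (U <= variety_meet V W)%O = (U <= V)%O && (U <= W)%O.
Proof.
apply/asboolP/andP => [UVW|[/asboolP UV /asboolP UW] S US].
  by split; apply/asboolP => S /UVW[].
by split; [apply: UV | apply: UW].
Qed.

Fact variety_joinP (V W U : variety) :
  (variety_join V W <= U)%O = (V <= U)%O && (W <= U)%O.
Proof.
apply/asboolP/andP => [VWU|[/asboolP VU /asboolP WU] S].
  split; apply/asboolP => S mS; apply: VWU => i []; first by move=> + _; apply.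
  by move=> _; apply.
have [s eU] := variety_equational U; move: VU WU; rewrite eU => VU WU VWS i si.
by apply: VWS; split=> T mT; [apply: VU mT _ si | apply: WU mT _ si].
Qed.

HB.instance Definition _ := Order.POrder_MeetJoin_isLattice.Build
  sem_display variety variety_meetP variety_joinP.

Definition SEM : Order.Lattice.type sem_display := variety.

Inductive lterm :=
  | LVar of nat
  | LJoin of lterm & lterm
  | LMeet of lterm & lterm.

Inductive lformula :=
  | LEq of lterm & lterm
  | LNot of lformula
  | LAnd of lformula & lformula
  | LOr of lformula & lformula
  | LImp of lformula & lformula
  | LAll of nat & lformula
  | LEx of nat & lformula.

Fixpoint term_vars (t : lterm) : seq nat :=
  match t with
  | LVar i => [:: i]
  | LJoin t u | LMeet t u => term_vars t ++ term_vars u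
  end.

Fixpoint free_vars (phi : lformula) : seq nat :=
  match phi with
  | LEq t u => term_vars t ++ term_vars u
  | LNot phi => free_vars phi
  | LAnd phi psi | LOr phi psi | LImp phi psi => free_vars phi ++ free_vars psi
  | LAll i phi | LEx i phi => [seq j <- free_vars phi | j != i]
  end.

Section Satisfaction.
Variables (d : Order.disp_t) (L : latticeType d).

Fixpoint eval_term (e : nat -> L) (t : lterm) : L :=
  match t with
  | LVar i => e i
  | LJoin t u => Order.join (eval_term e t) (eval_term e u)
  | LMeet t u => Order.meet (eval_term e t) (eval_term e u)
  end.

Fixpoint sat (e : nat -> L) (phi : lformula) : Prop :=
  match phi with
  | LEq t u => eval_term e t = eval_term e u
  | LNot phi => ~ sat e phi
  | LAnd phi psi => sat e phi /\ sat e psi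
  | LOr phi psi => sat e phi \/ sat e psi
  | LImp phi psi => sat e phi -> sat e psi
  | LAll i phi => forall a : L, sat [eta e with i |-> a] phi
  | LEx i phi => exists a : L, sat [eta e with i |-> a] phi
  end.

Definition definable (A : set L) :=
  exists (phi : lformula) (i : nat),
    free_vars phi =i [:: i] /\ forall e : nat -> L, sat e phi <-> A (e i).

End Satisfaction.

Definition varieties_of (P : semigroup -> Prop) : set SEM :=
  [set V : variety | forall S, members V S -> P S].

(* Main.v *)
From mathcomp Require Import all_boot all_order.
From mathcomp Require Import boolp classical_sets.
Require Import Defs.

Set Implicit Arguments.
Unset Strict Implicit.
Unset Printing Implicit Defensive.

Import Order.Theory.

Local Open Scope classical_set_scope.
Local Open Scope group_scope.

(** Every nontrivial variety contains one of the following semigroups: the left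
zero, right zero, null and semilattice semigroups on two elements, and the
groups of prime order. They generate the atoms LZ, RZ, ZM, SL and A_p of the
lattice, and each of the six classes consists of the varieties that avoid some
of these atoms:
- completely regular: ZM;
- completely simple: ZM and SL;
- periodic groups: ZM, SL, LZ and RZ;
- combinatorial: all A_p;
- idempotent semigroups: ZM and all A_p;
- nil: all atoms but ZM.
These descriptions ([completely_regularP] to [nilP]) come from identities: a
variety without the semigroup X satisfies an identity that fails in X for some
assignment of the letters, and that assignment tells which substitution turns
the identity into a useful law. For instance an identity that fails in ZM
becomes x = x ^ k with k > 1 after all its letters are identified.

It remains to tell ZM, SL and the set of all A_p apart by lattice properties.
Two properties of an atom suffice.

An atom a is isolated if no other variety has a as its only atom. LZ, RZ and SL
are isolated, since a variety that contains neither ZM nor any A_p consists of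
bands. ZM is not, as there are larger nil-varieties, and A_p is not, because of
the groups of exponent p ^ 2.

Two atoms a and b are linked if some variety has no atoms besides a and b, has
no subvariety with just one atom other than that atom, and is not below the join
of a and b. An atom is central if it is linked to all the other isolated atoms.
SL and ZM are central: explicit identities define the required varieties
([linked_semilattice_left_zero], [linked_null_left_zero],
[linked_null_semilattice]), and duality takes care of RZ. LZ and RZ are not
central: a variety with no other atoms consists of rectangular bands, so it lies
below the join of LZ and RZ. Neither is A_p: a variety with no atoms besides LZ
and A_p consists of left groups, which are products of a left zero semigroup and
a group, and the condition on subvarieties puts that group into A_p.

So SL is the central isolated atom, ZM the central atom that is not isolated,
and the A_p are the atoms that are neither central nor isolated. *)

(** * Powers and values of words *)

Lemma powerSr (S : semigroup) (x : S) n : power x n.+1 = power x n * x.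
Proof. by elim: n => //= n IHn; rewrite {1}IHn mulgA. Qed.

Lemma powerD (S : semigroup) (x : S) m n :
  power x m * power x n = power x (m + n).+1.
Proof. by elim: m => //= m IHm; rewrite -mulgA IHm. Qed.

Lemma power_idem (S : semigroup) (e : S) n : e * e = e -> power e n = e.
Proof. by move=> ee; elim: n => //= n ->. Qed.

Lemma eval_word_cons (S : semigroup) (f : nat -> S) i j s :
  eval_word f (i, j :: s) = f i * eval_word f (j, s).
Proof.
rewrite /eval_word /=; elim: s (f j) => //= k s IHs a.
by rewrite -mulgA IHs.
Qed.

Lemma eval_word_rcons (S : semigroup) (f : nat -> S) i s j :
  eval_word f (i, rcons s j) = eval_word f (i, s) * f j.
Proof. by rewrite /eval_word /= foldl_rcons. Qed.

Lemma eval_word_hom (X S : semigroup) (h : X -> S) (f : nat -> X) w :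
  {morph h : x y / x * y} -> eval_word (h \o f) w = h (eval_word f w).
Proof.
move=> hM; case: w => i s; elim/last_ind: s => [//|s j IHs].
by rewrite !eval_word_rcons IHs hM.
Qed.

Definition letters (w : word) : seq nat := w.1 :: w.2.

Lemma all_letters_rcons (p : pred nat) i s j :
  all p (letters (i, rcons s j)) = all p (letters (i, s)) && p j.
Proof. by rewrite /= all_rcons (andbC (p j)) andbA. Qed.

Lemma eval_word_ind (S : semigroup) (P : S -> Prop) (f : nat -> S) w :
  (forall x y, P x -> P y -> P (x * y)) ->
  (forall i, i \in letters w -> P (f i)) -> P (eval_word f w).
Proof.
move=> PM; case: w => i s; elim/last_ind: s => [|s j IHs] Pf.
  by apply: Pf; rewrite mem_head.
rewrite eval_word_rcons; apply: PM; last first.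
  by apply: Pf; rewrite /letters /= inE mem_rcons mem_head orbT.
apply: IHs => k; rewrite /letters /= inE => /orP[/eqP->|ks]; apply: Pf.
  by rewrite mem_head.
by rewrite /letters /= inE mem_rcons inE ks !orbT.
Qed.

Lemma eval_word_absorb (S : semigroup) (e : S) (f : nat -> S) w :
  e * f w.1 = f w.1 -> e * eval_word f w = eval_word f w.
Proof.
by case: w => i [|j s] //= ei; rewrite eval_word_cons mulgA ei.
Qed.

(** x_0 ^ (n + 1) x_1, with the exponent shifted as in [power]. *)
Definition power_word n : word := (0, rcons (nseq n 0) 1)%N.

Lemma eval_power_word (S : semigroup) (f : nat -> S) n :
  eval_word f (power_word n) = power (f 0%N) n * f 1%N.
Proof.
rewrite eval_word_rcons; congr (_ * _).
by elim: n => [//|n IHn]; rewrite eval_word_cons IHn.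
Qed.

(** * Varieties *)

Definition variety_of (Sigma : set identity) : variety :=
  MkVariety (ex_intro (fun T => models Sigma = models T) Sigma erefl).

Definition var (X : semigroup) : variety :=
  variety_of (identities_of [set X]).

Lemma leVP (V W : variety) : (V <= W)%O <-> (forall S, members V S -> members W S).
Proof. by split=> [/asboolP|VW]; [|apply/asboolP]. Qed.

Lemma var_satisfies X S i : members (var X) S -> satisfies X i -> satisfies S i.
Proof. by move=> XS Xi; apply: XS => _ ->. Qed.

Lemma var_self X : members (var X) X.
Proof. by move=> i; apply. Qed.

Lemma var_le X (V : variety) : (var X <= V)%O <-> members V X.
Proof.
split=> [/leVP|VX]; first by apply; exact: var_self.
apply/leVP => S XS; have [Sigma eV] := variety_equational V.
move: VX; rewrite eV => VX i si; apply: (var_satisfies XS); exact: VX.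
Qed.

(** The assignment f is kept because it suggests the substitution that makes the
identity useful in the members of V. *)
Lemma excluded_identity (V : variety) X : ~ members V X ->
  exists i, (forall S, members V S -> satisfies S i) /\
    exists f : nat -> X, eval_word f i.1 <> eval_word f i.2.
Proof.
have [Sigma eV] := variety_equational V; rewrite eV => nVX.
apply: contrapT => nex; apply: nVX => i si f; apply: contrapT => nf.
by apply: nex; exists i; split=> [S|]; [exact | exists f].
Qed.

Lemma sub_variety (V : variety) (X S : semigroup) (h : X -> S) :
  members V S -> injective h -> {morph h : x y / x * y} -> members V X.
Proof.
have [Sigma ->] := variety_equational V => VS h_inj hM i si f.
by apply: h_inj; rewrite -!(eval_word_hom _ _ hM); apply: VS.
Qed.

Lemma join_satisfies (V W : SEM) i S : members (Order.join V W) S ->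
  (forall T, members V T -> satisfies T i) ->
  (forall T, members W T -> satisfies T i) -> satisfies S i.
Proof. by move=> VWS Vi Wi; apply: VWS; split. Qed.

(** * Duality *)

Definition dual (S : semigroup) : semigroup :=
  @MkSemigroup S (fun x y => y * x)
    (fun x y z => esym (mulgA z y x)) (semigroup_inhabited S).

Lemma semigroup_eq (T : Type) (op op' : T -> T -> T) A A' i i' :
  op = op' -> @MkSemigroup T op A i = @MkSemigroup T op' A' i'.
Proof.
move=> e; subst op'.
by rewrite (Prop_irrelevance A A') (Prop_irrelevance i i').
Qed.

Lemma dualK : involutive dual.
Proof. by case=> T op A i; exact: semigroup_eq. Qed.

Lemma dual_commutative (S : semigroup) :
  (forall x y : S, x * y = y * x) -> dual S = S.
Proof.
case: S => T op A i C; apply: semigroup_eq.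
by apply/funext => x; apply/funext => y; rewrite -[LHS]C.
Qed.

Definition rev_word (w : word) : word := (last w.1 w.2, rev (belast w.1 w.2)).

Lemma eval_dual (S : semigroup) (f : nat -> S) w :
  eval_word (f : nat -> dual S) w = eval_word f (rev_word w).
Proof.
case: w => i s; elim/last_ind: s => [//|s j IHs].
rewrite eval_word_rcons /rev_word /= last_rcons belast_rcons.
by rewrite lastI rev_rcons eval_word_cons -[(last _ _, _)]/(rev_word (i, s)) -IHs.
Qed.

Lemma dual_variety_equational (V : variety) :
  exists Sigma, [set S | members V (dual S)] = models Sigma.
Proof.
have [Sigma eV] := variety_equational V; rewrite eV.
exists [set i | exists2 j, Sigma j & i = (rev_word j.1, rev_word j.2)].
apply/seteqP; split=> S /= VS.
  by move=> _ [j sj ->] f; rewrite /= -!eval_dual; exact: VS.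
move=> j sj f; rewrite !(@eval_dual S f).
by apply: (VS (rev_word j.1, rev_word j.2)); exists j.
Qed.

Definition dual_variety (V : variety) : variety :=
  MkVariety (dual_variety_equational V).

Lemma dual_varietyK : involutive dual_variety.
Proof.
by move=> V; apply: variety_eq; apply/seteqP; split=> S /=; rewrite dualK.
Qed.

Lemma dual_variety_le (V W : variety) :
  (V <= dual_variety W)%O = (dual_variety V <= W)%O.
Proof.
apply/idP/idP => /leVP VW; apply/leVP => S.
  by move=> /VW /=; rewrite dualK.
by move=> VS; apply: VW => /=; rewrite dualK.
Qed.

Lemma dual_var X : dual_variety (var X) = var (dual X).
Proof.
apply/le_anti/andP; split; last by apply/var_le; rewrite /= dualK; exact: var_self.
by rewrite -dual_variety_le; apply/var_le; exact: var_self.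
Qed.

(** * The semigroups that generate the atoms *)

Definition left_zero : semigroup :=
  @MkSemigroup bool (fun x _ => x) (fun _ _ _ => erefl) (inhabits true).

Definition right_zero : semigroup := dual left_zero.

Definition semilattice2 : semigroup :=
  @MkSemigroup bool andb andbA (inhabits true).

Definition null2 : semigroup :=
  @MkSemigroup bool (fun _ _ => false) (fun _ _ _ => erefl) (inhabits true).

Definition residue (p i : nat) : {i : nat | i < p.-1.+1}%N :=
  exist _ (i %% p.-1.+1)%N (ltn_pmod i (ltn0Sn p.-1)).

Fact residue_addA p :
  associative (fun i j : {i : nat | i < p.-1.+1}%N =>
    residue p (sval i + sval j)).
Proof. by move=> i j k; apply: val_inj; rewrite /= modnDmr modnDml addnA. Qed.

(** The additive group of integers modulo p, for p > 0; the carrier is written so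
that it has an element for every p. *)
Definition cyclic p : semigroup :=
  MkSemigroup (@residue_addA p) (inhabits (residue p 0)).

Fact exponent_addA : associative (fun m n => (m + n).+1).
Proof. by move=> m n k; rewrite addSn addnS addnA. Qed.

(** The free monogenic semigroup; n stands for the exponent n + 1, as in
[power]. *)
Definition exponents : semigroup := MkSemigroup exponent_addA (inhabits 0%N).

Lemma power_exponent (S : semigroup) (x : S) :
  {morph (power x : exponents -> S) : m n / m * n}.
Proof. by move=> m n; rewrite powerD. Qed.

Lemma residue_exponent p :
  {morph ((fun n => residue p n.+1) : exponents -> cyclic p) : m n / m * n}.
Proof.
by move=> m n; apply: val_inj; rewrite /= modnDm addSn addnS.
Qed.

Lemma eval_left_zero (f : nat -> left_zero) w : eval_word f w = f w.1.
Proof.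
by case: w => i s; elim/last_ind: s => // s j IHs; rewrite eval_word_rcons.
Qed.

Lemma eval_semilattice2 (f : nat -> semilattice2) w :
  eval_word f w = all f (letters w).
Proof.
case: w => i s; elim/last_ind: s => [|s j IHs]; first by rewrite /= andbT.
by rewrite eval_word_rcons IHs all_letters_rcons.
Qed.

Lemma eval_null2 (f : nat -> null2) w :
  eval_word f w = nilp w.2 && f w.1.
Proof.
case: w => i s; elim/last_ind: s => // s j _.
by rewrite eval_word_rcons /nilp size_rcons.
Qed.

Lemma eval_const (S : semigroup) (x : S) w :
  eval_word (fun=> x) w = power x (size w.2).
Proof.
case: w => i s; elim/last_ind: s => // s j IHs.
by rewrite eval_word_rcons IHs -powerSr size_rcons.
Qed.

(** * What the absence of each of these semigroups forces *)

(** An identity fails in a null semigroup only if one side is a single letter.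
Identifying all letters gives x = x ^ k with k > 1, unless both sides are single
letters, in which case the variety is trivial. *)
Lemma excluded_null (V : variety) : ~ members V null2 ->
  exists n, forall S, members V S -> forall x : S, power x n.+1 = x.
Proof.
move=> /excluded_identity[[u v] [Vuv [f]]]; rewrite !eval_null2 /= => fuv.
wlog u1 : u v Vuv fuv / nilp u.2.
  move=> th; have [u1|u1] := boolP (nilp u.2); first exact: th fuv u1.
  have [v1|v1] := boolP (nilp v.2); last first.
    by case: fuv; rewrite (negbTE u1) (negbTE v1).
  by apply: (th v u) v1; [move=> S VS g; symmetry; apply: (Vuv S)|exact: nesym].
case: u u1 Vuv fuv => i [|//] _; case: v => j [|k s] /= Vuv fij.
  exists 0%N => S VS x; have := Vuv S VS (fun l => if l == j then x * x else x).
  by rewrite /eval_word /= eqxx; case: eqP => // ij; case: fij; rewrite ij.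
exists (size s) => S VS x; have := Vuv S VS (fun=> x).
by rewrite !eval_const.
Qed.

(** The failing values are lifted from residues to exponents of x, where both
sides of the identity can be compared. *)
Lemma excluded_cyclic (V : variety) p (S : semigroup) (x : S) :
  (0 < p)%N -> ~ members V (cyclic p) -> members V S ->
  exists m d, power x m = power x (m + d.+1) /\ ~~ (p %| d.+1)%N.
Proof.
move=> p_gt0 /excluded_identity[[u v] [Vuv [f fuv]]] VS.
(* Adding p - 1 keeps the exponents positive. *)
pose g i : exponents := (sval (f i) + p.-1)%N.
have fE : f = (fun n : exponents => residue p n.+1 : cyclic p) \o g.
  apply/funext => i; apply: val_inj => /=.
  by rewrite -addnS modnDr modn_small //; exact: (svalP (f i)).
have xuv : power x (eval_word g u) = power x (eval_word g v).
  rewrite -!(eval_word_hom _ _ (power_exponent x)); exact: Vuv.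
have neq_uv : (eval_word g u).+1 <> (eval_word g v).+1 %[mod p].
  move=> uv; apply: fuv; rewrite fE /= !(eval_word_hom _ _ (@residue_exponent p)).
  by apply: val_inj; rewrite /= (prednK p_gt0).
move: (eval_word g u) (eval_word g v) xuv neq_uv => m n xmn neq_mn.
wlog lt_mn : m n xmn neq_mn / (m < n)%N.
  move=> th; have [|lt_nm|eq_mn] := ltngtP m n; first exact: th xmn neq_mn.
    by apply: (th n m) => //; exact: nesym.
  by case: neq_mn; rewrite eq_mn.
exists m, (n - m.+1)%N; rewrite addnS -addSn subnKC //; split=> //.
apply/negP => pd; apply: neq_mn; rewrite -(subnKC lt_mn) -addnS.
by rewrite -modnDmr (eqP pd) addn0.
Qed.

(** The letters on which the failing assignment is 1 are sent to e and the others
to z: then one side of the identity becomes e and the other a power of z. *)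
Lemma excluded_semilattice (V : variety) (S : semigroup) (e z : S) :
  ~ members V semilattice2 -> members V S ->
  e * e = e -> e * z = z -> z * e = z -> exists k, power z k = e.
Proof.
move=> /excluded_identity[[u v] [Vuv [f]]].
rewrite !eval_semilattice2 => fuv VS ee ez ze.
wlog [fv fu] : u v Vuv fuv / all f (letters v) /\ ~~ all f (letters u).
  move=> th; case fv: (all f (letters v)); case fu: (all f (letters u)).
  - by case: fuv; rewrite fv fu.
  - by apply: (th u v); rewrite ?fv ?fu.
  - apply: (th v u) => //; last by rewrite fv fu.
      by move=> T VT g; symmetry; apply: (Vuv T).
    exact: nesym.
  - by case: fuv; rewrite fv fu.
pose g i := if f i then e else z.
have gw w : if all f (letters w) then eval_word g w = e
            else exists k, eval_word g w = power z k.
  case: w => i s; elim/last_ind: s => [|s j].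
    by rewrite /= andbT /eval_word /g /=; case: (f i) => //; exists 0%N.
  rewrite all_letters_rcons eval_word_rcons /g; case: (f j).
    rewrite andbT; case: all => [->//|[k ->]]; exists k.
    by case: k => [//|k]; rewrite powerSr -mulgA ze.
  rewrite andbF; case: all => [->|[k ->]]; first by exists 0%N.
  by exists k.+1; rewrite powerSr.
move: (gw u) (gw v); rewrite fv (negbTE fu) => -[k uk] ve.
by exists k; rewrite -uk -ve; apply: (Vuv S VS g).
Qed.

(** Such an identity has sides with different first letters, which are sent to e
and f. *)
Lemma excluded_left_zero (V : variety) (S : semigroup) (e f : S) :
  ~ members V left_zero -> members V S -> e * e = e -> f * f = f ->
  exists z, e * z = z /\ f * z = z.
Proof.
move=> /excluded_identity[[u v] [Vuv [h]]]; rewrite !eval_left_zero /= => huv VS.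
have uv : u.1 != v.1 by apply/eqP => uv; apply: huv; rewrite uv.
move=> ee ff; pose g i := if i == u.1 then e else f.
exists (eval_word g u); split.
  by apply: eval_word_absorb; rewrite /g eqxx.
have -> : eval_word g u = eval_word g v by apply: (Vuv S VS g).
by apply: eval_word_absorb; rewrite /g eq_sym (negbTE uv).
Qed.

Lemma excluded_left_zero_pair (V : variety) (S : semigroup) (a b : S) :
  ~ members V left_zero -> members V S ->
  a * a = a -> b * b = b -> a * b = a -> b * a = b -> a = b.
Proof.
move=> nLZ VS aa bb ab ba; apply: contrapT => neq; apply: nLZ.
apply: (@sub_variety _ left_zero S (fun t : bool => if t then a else b) VS).
  by move=> [] [] // E; case: neq.
by move=> [] [].
Qed.

Lemma power_absorb (S : semigroup) (f z : S) k :
  f * z = z -> f * power z k = power z k.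
Proof. by case: k => //= k fz; rewrite mulgA fz. Qed.

(** Without semilattices each e is a power of every element of eSe, so the
element absorbed on the left by both e and f may be replaced by e. *)
Lemma idempotents_left (V : variety) (S : semigroup) (e f : S) :
  ~ members V semilattice2 -> ~ members V left_zero -> members V S ->
  e * e = e -> f * f = f -> f * e = e.
Proof.
move=> nSL nLZ VS ee ff; have [z [ez fz]] := excluded_left_zero nLZ VS ee ff.
have [||k <-] := @excluded_semilattice _ _ e (z * e) nSL VS ee.
- by rewrite mulgA ez.
- by rewrite -mulgA ee.
by apply: power_absorb; rewrite mulgA fz.
Qed.

Lemma dual_semilattice2 : dual semilattice2 = semilattice2.
Proof. by apply: dual_commutative => x y; exact: andbC. Qed.

Lemma dual_null2 : dual null2 = null2.
Proof. exact: dual_commutative. Qed.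

Lemma idempotents_right (V : variety) (S : semigroup) (e f : S) :
  ~ members V semilattice2 -> ~ members V right_zero -> members V S ->
  e * e = e -> f * f = f -> e * f = e.
Proof.
move=> nSL nRZ VS.
apply: (@idempotents_left (dual_variety V) (dual S)) => //=.
- by rewrite dual_semilattice2.
- by rewrite dualK.
Qed.

(** * Subgroups *)

(** The group of units of eSe, the largest subgroup with identity e. *)
Definition unit_group (S : semigroup) (e : S) : set S :=
  [set x | [/\ e * x = x, x * e = x &
    exists2 y, e * y = y /\ y * e = y & x * y = e /\ y * x = e]].

Lemma unit_group_subgroup (S : semigroup) (e : S) :
  e * e = e -> is_subgroup (unit_group e).
Proof.
move=> ee; split.
  move=> x y [ex xe [x' [ex' xe'] [xx' x'x]]] [ey ye [y' [ey' ye'] [yy' y'y]]].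
  split; [by rewrite mulgA ex | by rewrite -mulgA ye | exists (y' * x')].
    by rewrite mulgA ey' -mulgA xe'.
  split; first by rewrite -mulgA (mulgA y) yy' ex'.
  by rewrite -mulgA (mulgA x') x'x ey.
exists e; first by split=> [|x []] //; split=> //; exists e.
by move=> x [ex xe [y [ey ye] [xy yx]]]; exists y => //; split=> //; exists x.
Qed.

Lemma mem_unit_group (S : semigroup) (e x : S) n :
  e * x = x -> x * e = x -> power x n = e -> unit_group e x.
Proof.
move=> ex xe xn; have ee : e * e = e.
  by rewrite -{2 3}xn power_absorb.
split=> //; exists (power x (n + n)).
  split; first exact: power_absorb.
  by case: (n + n)%N => // k; rewrite powerSr -mulgA xe.
by rewrite -powerSr -[x * _]/(power x (n + n).+1) -powerD xn.
Qed.

Lemma periodic_identity (S : semigroup) (x : S) n : power x n.+1 = x ->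
  [/\ power x n * x = x, x * power x n = x & power x n * power x n = power x n].
Proof.
move=> xn; rewrite -powerSr; split=> //; case: n xn => [//|n] xn.
by rewrite {1}powerSr -mulgA -[x * power x n.+1]/(power x n.+2) xn -powerSr.
Qed.

Lemma subgroup_power (S : semigroup) (G : set S) (x : S) n :
  is_subgroup G -> G x -> G (power x n).
Proof. by move=> [GM _] Gx; elim: n => //= n; apply: GM. Qed.

(** The hypothesis provides, for each prime p, a period of x that p does not
divide. So no prime divides the order of x. *)
Lemma subgroup_element_trivial (S : semigroup) (G : set S) (e x : S) :
  is_subgroup G -> is_identity_of G e -> G x ->
  (forall p, prime p ->
     exists m d, power x m = power x (m + d.+1) /\ ~~ (p %| d.+1)%N) -> x = e.
Proof.
move=> gG [Ge idG] Gx xp.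
have [_ [e' [Ge' id'] invG]] := gG.
have ee' : e' = e by rewrite -(idG _ Ge').1 (id' _ Ge).2.
subst e'.
have period p : prime p -> exists2 d, power x d = e & ~~ (p %| d.+1)%N.
  move=> pp; have [m [d [xmd pd]]] := xp p pp; exists d => //.
  have [y Gy [_ yx]] := invG _ (subgroup_power m gG Gx).
  have Gd := subgroup_power d gG Gx.
  by rewrite -(idG _ Gd).1 -yx -mulgA powerD -addnS -xmd.
have [n xn n_min] : exists2 n, power x n = e & forall m, (m < n)%N -> power x m <> e.
  have [d xd _] := period 2 isT.
  elim/ltn_ind: d xd => d IHd xd.
  have [[m [md xm]]|nm] := pselect (exists m, (m < d)%N /\ power x m = e).
    exact: IHd xm.
  by exists d => // m md xm; apply: nm; exists m.
case: n xn n_min => [xn _|n xn n_min]; first exact: xn.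
have [d xd] := period _ (pdiv_prime (isT : 1 < n.+2)%N).
case/negP; apply: dvdn_trans (pdiv_dvd _) _.
have red k m : (m < n.+2)%N -> power x (k * n.+2 + m) = power x m.
  move=> _; elim: k => // k IHk.
  have -> : (k.+1 * n.+2 + m = (n.+1 + (k * n.+2 + m)).+1)%N.
    by rewrite mulSn -addnA addSn.
  by rewrite -powerD xn IHk (idG _ (subgroup_power m gG Gx)).1.
rewrite /dvdn; apply/eqP; case E: (d.+1 %% n.+2)%N => [//|r].
have r_lt : (r.+1 < n.+2)%N by rewrite -E ltn_mod.
case: (n_min r); first by rewrite ltnS in r_lt.
rewrite -(red (d.+1 %/ n.+2)%N); last exact: ltnW.
by rewrite -xd; congr power; apply: succn_inj; rewrite -addnS -E -divn_eq.
Qed.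

Lemma combinatorial_without_cyclic (V : variety) S :
  (forall p, prime p -> ~ members V (cyclic p)) -> members V S ->
  combinatorial S.
Proof.
move=> nA VS G gG; have [_ [e idG _]] := gG.
have triv x : G x -> x = e.
  move=> Gx; apply: (subgroup_element_trivial gG idG Gx) => p pp.
  exact: excluded_cyclic (prime_gt0 pp) (nA p pp) VS.
by move=> x y /triv -> /triv ->.
Qed.

(** * The six classes in terms of excluded semigroups *)

Lemma residueE p (x : cyclic p) : x = residue p (sval x).
Proof. by apply: val_inj; rewrite /= modn_small //; exact: (svalP x). Qed.

Lemma residueM p i j :
  (residue p i : cyclic p) * residue p j = residue p (i + j).
Proof. by apply: val_inj; rewrite /= modnDm. Qed.

Lemma power_residue p i n :
  power (residue p i : cyclic p) n = residue p (n.+1 * i).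
Proof.
elim: n => [|n IHn]; first by rewrite mul1n.
by rewrite [LHS]/= IHn residueM -mulSn.
Qed.

Lemma eq_residue p i j :
  (0 < p)%N -> residue p i = residue p j <-> i = j %[mod p].
Proof.
move=> p_gt0; split=> [/(congr1 sval) /=|ij]; first by rewrite prednK.
by apply: val_inj; rewrite /= prednK.
Qed.

Lemma residue0_neq1 p : prime p -> residue p 0 <> residue p 1.
Proof.
move=> pp /(eq_residue _ _ (prime_gt0 pp)).
by rewrite mod0n modn_small // prime_gt1.
Qed.

Lemma residue_absorb p (z : cyclic p) : prime p -> z * residue p 1 <> z.
Proof.
case: z => i ip pp /(congr1 sval) /= /eqP; move: ip.
have p_gt1 := prime_gt1 pp; rewrite prednK ?(ltnW p_gt1) // => ip.
rewrite modnDmr -[X in _ == X](modn_small ip) -[X in _ == X %% _]addn0.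
by rewrite eqn_modDl modn_small // mod0n.
Qed.

Lemma completely_regularP (V : variety) :
  varieties_of completely_regular V <-> ~ members V null2.
Proof.
split=> [VP /VP /(_ true)[G [GM [e [_ idG] _]] /idG[]]//|nN S VS x].
have [n /(_ S VS x) xn] := excluded_null nN.
have [ex xe ee] := periodic_identity xn.
exists (unit_group (power x n)); first exact: unit_group_subgroup.
exact: mem_unit_group ex xe erefl.
Qed.

Lemma bool_ideal_neq_setT : [set false] <> [set: bool].
Proof. by move=> /seteqP[_ /(_ true I)]. Qed.

(** Without semilattices an idempotent e is a power of exe, for every x; so e
belongs to every ideal, and e is the only idempotent below e. *)
Lemma completely_simpleP (V : variety) :
  varieties_of completely_simple V <->
  ~ members V null2 /\ ~ members V semilattice2.
Proof.
split=> [VP|[nN nSL] S VS].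
  split=> /VP[simple _]; apply: bool_ideal_neq_setT; apply: simple.
    by split=> [|x y _]; [exists false | split].
  by split=> [|x y ->]; [exists false | split=> //=; case: y].
have [n /(_ S VS) perS] := excluded_null nN.
have small (e x : S) : e * e = e -> exists k, power (e * x * e) k = e.
  by move=> ee; apply: (excluded_semilattice nSL VS) => //;
    rewrite ?mulgA ?ee // -mulgA ee.
split.
  move=> I [[x Ix] idI]; apply/seteqP; split=> // y _.
  have [_ ye ee] := periodic_identity (perS y).
  have [k ek] := small _ x ee.
  rewrite -ye -{}ek; apply: (idI _ _ _).2.
  have Iz : I (power y n * x * power y n).
    by apply: (idI _ _ _).1; apply: (idI _ _ Ix).2.
  by elim: k => //= k Ik; apply: (idI _ _ Iz).1.
have [x] := semigroup_inhabited S.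
have [_ _ ee] := periodic_identity (perS x).
exists (power x n); split=> // f ff ef fe.
have [k <-] := small _ f ee; rewrite ef fe.
by rewrite power_idem.
Qed.

(** Without left and right zero semigroups any idempotents e and f satisfy
e = fe = f. *)
Lemma periodic_groupP (V : variety) :
  varieties_of periodic_group V <->
  [/\ ~ members V null2, ~ members V semilattice2,
      ~ members V left_zero & ~ members V right_zero].
Proof.
split=> [VP|[nN nSL nLZ nRZ] S VS].
  split=> /VP[[_ [e [_ ide] inve]] _].
  - by have [] := ide true I.
  - have [y _ [/= ey _]] := inve false I.
    by move: (ide true I).1; rewrite -ey.
  - by move: (ide (~~ e) I).1 => /=; case: (e).
  - by move: (ide (~~ e) I).2 => /=; case: (e).
have [n /(_ S VS) perS] := excluded_null nN.
have [x0] := semigroup_inhabited S.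
have one_idem (x y : S) : power x n = power y n.
  have [_ _ ex] := periodic_identity (perS x).
  have [_ _ ey] := periodic_identity (perS y).
  rewrite -(idempotents_left nSL nLZ VS ex ey).
  exact: (idempotents_right nSL nRZ VS ey ex).
set e := power x0 n.
have id x : e * x = x /\ x * e = x.
  by rewrite /e (one_idem x0 x); have [? ?] := periodic_identity (perS x).
split; last by exists e => [|x]; [split | exists n; exact: one_idem].
split=> //; exists e; first by split.
move=> x _; exists (power x (n + n)) => //.
rewrite -powerSr -[x * _]/(power x (n + n).+1) -powerD (one_idem x x0).
by rewrite (id _).1.
Qed.

Lemma combinatorialP (V : variety) :
  varieties_of combinatorial V <-> forall p, prime p -> ~ members V (cyclic p).
Proof.
split=> [VP p pp /VP comb|nA S VS]; last exact: combinatorial_without_cyclic VS.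
apply: (residue0_neq1 pp); apply: (comb setT) => //; split=> //.
exists (residue p 0); first split=> // x _.
  by rewrite (residueE x) !residueM addn0.
move=> x _; exists (residue p (p - sval x)) => //.
have xp : (sval x <= p)%N.
  by apply: ltnW; rewrite -{2}(prednK (prime_gt0 pp)); exact: (svalP x).
have p0 : residue p p = residue p 0.
  by apply/eq_residue; rewrite ?prime_gt0 // modnn mod0n.
by rewrite {1 4}(residueE x) !residueM subnK // subnKC.
Qed.

Lemma idempotentP (V : variety) :
  varieties_of idempotent_semigroup V <->
  ~ members V null2 /\ forall p, prime p -> ~ members V (cyclic p).
Proof.
split=> [VP|[nN nA] S VS x].
  split=> [/VP /(_ true)//|p pp /VP /(_ (residue p 1))].
  exact: residue_absorb.
have [n /(_ S VS x) xn] := excluded_null nN.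
have [ex xe ee] := periodic_identity xn.
have gE := unit_group_subgroup ee.
suff -> : x = power x n by [].
apply: (combinatorial_without_cyclic nA VS gE).
  exact: mem_unit_group ex xe erefl.
exact: (mem_unit_group ee ee (power_idem 0 ee)).
Qed.

(** Beyond the index m of x the powers repeat with period d; a multiple of d
beyond the index is the exponent of an idempotent. *)
Lemma idempotent_power (S : semigroup) (x : S) m d :
  power x m = power x (m + d.+1) -> exists n, power x n * power x n = power x n.
Proof.
move=> xmd; have step r : power x (r + m) = power x (r + m + d.+1).
  by elim: r => [//|r IHr]; rewrite !addSn /= IHr.
have steps r k : power x (r + m + k * d.+1) = power x (r + m).
  elim: k => [|k IHk]; first by rewrite addn0.
  by rewrite mulSnr addnA (addnAC r m) -step addnAC IHk.
exists (m.+1 * d.+1).-1; rewrite powerD -addnS prednK ?muln_gt0 //.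
have le_mn : (m <= (m.+1 * d.+1).-1)%N.
  by rewrite -ltnS prednK ?muln_gt0 // leq_pmulr.
by rewrite -(subnK le_mn) steps.
Qed.

(** The absence of a single cyclic group makes all elements periodic. Their
idempotent powers coincide as in a periodic group, and this only idempotent z
is a zero, since zx lies in the subgroup with identity z, which is trivial. *)
Lemma nilP (V : variety) :
  varieties_of nilsemigroup V <->
  [/\ ~ members V semilattice2, ~ members V left_zero, ~ members V right_zero &
      forall p, prime p -> ~ members V (cyclic p)].
Proof.
split=> [VP|[nSL nLZ nRZ nA] S VS].
  split=> [/VP[z zz tz]|/VP[z zz _]|/VP[z zz _]|p pp /VP[z zz _]].
  - have [n] := tz true; rewrite power_idem // => zE.
    by move: (zz false).1; rewrite -zE.
  - by move: (zz (~~ z)).2 => /=; case: (z).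
  - by move: (zz (~~ z)).1 => /=; case: (z).
  - exact: (residue_absorb pp (zz _).1).
have comb := combinatorial_without_cyclic nA VS.
have idem_power (x : S) : exists n, power x n * power x n = power x n.
  have [m [d [xmd _]]] := excluded_cyclic x (isT : 0 < 2)%N (nA 2 isT) VS.
  exact: idempotent_power xmd.
have [x0] := semigroup_inhabited S; have [n0 zz] := idem_power x0.
set z := power x0 n0 in zz.
have power_z x : exists n, power x n = z.
  have [n ee] := idem_power x; exists n.
  rewrite -(idempotents_left nSL nLZ VS ee zz).
  exact: (idempotents_right nSL nRZ VS zz ee).
exists z => // x; have [n xn] := power_z x.
have xz : x * z = z * x by rewrite -xn -powerSr.
suff zx : z * x = z by rewrite xz zx.
apply: (comb _ (unit_group_subgroup zz)).
  have zxk k : power (z * x) k = z * power x k.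
    by elim: k => //= k ->; rewrite mulgA -(mulgA z x z) xz !mulgA zz.
  apply: (@mem_unit_group _ _ _ n); last by rewrite zxk xn.
    by rewrite mulgA zz.
  by rewrite -mulgA xz mulgA zz.
exact: (mem_unit_group zz zz (power_idem 0 zz)).
Qed.

(** * First-order properties of atoms in a lattice *)

Section LatticePredicates.
Context {d : Order.disp_t} {L : latticeType d}.
Implicit Types a b c v w : L.

Definition is_bottom a := forall b, (a <= b)%O.

Definition is_atom a :=
  ~ is_bottom a /\ forall b, (b <= a)%O -> is_bottom b \/ b = a.

Definition atoms_among v a b :=
  forall c, is_atom c -> (c <= v)%O -> c = a \/ c = b.

(** Among the atoms of the lattice of varieties, those generated by bands: nil
varieties and varieties of p-groups need not stop at their atom. *)
Definition isolated a := is_atom a /\ forall v, atoms_among v a a -> (v <= a)%O.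

(** Thinness excludes the trivial reason for v not to be below the join of its
atoms, a larger subvariety over one of them. *)
Definition thin v :=
  forall w c, (w <= v)%O -> is_atom c -> atoms_among w c c -> (w <= c)%O.

Definition linked a b :=
  exists v, [/\ atoms_among v a b, thin v & ~ (v <= Order.join a b)%O].

Definition central a := forall b, isolated b -> b <> a -> linked a b.

End LatticePredicates.

(** In the formulas below k is a lower bound of the bound variables; the other
arguments are the free variables, kept smaller than k to avoid capture. *)
Definition f_le i j := LEq (LMeet (LVar i) (LVar j)) (LVar i).

Definition f_le_join i j k :=
  LEq (LMeet (LVar i) (LJoin (LVar j) (LVar k))) (LVar i).

Definition f_eq i j := LEq (LVar i) (LVar j).

Definition f_bottom k i := LAll k (f_le i k).

Definition f_atom k i :=
  LAnd (LNot (f_bottom k i))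
    (LAll k (LImp (f_le k i) (LOr (f_bottom k.+1 k) (f_eq k i)))).

Definition f_atoms_among k v a b :=
  LAll k (LImp (f_atom k.+1 k) (LImp (f_le k v) (LOr (f_eq k a) (f_eq k b)))).

Definition f_isolated k a :=
  LAnd (f_atom k a) (LAll k (LImp (f_atoms_among k.+1 k a a) (f_le k a))).

Definition f_thin k v :=
  LAll k (LAll k.+1 (LImp (f_le k v) (LImp (f_atom k.+2 k.+1)
    (LImp (f_atoms_among k.+2 k k.+1 k.+1) (f_le k k.+1))))).

Definition f_linked k a b :=
  LEx k (LAnd (f_atoms_among k.+1 k a b) (LAnd (f_thin k.+1 k)
    (LNot (f_le_join k a b)))).

Definition f_central k a :=
  LAll k (LImp (f_isolated k.+1 k) (LImp (LNot (f_eq k a)) (f_linked k.+1 a k))).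

Section FormulaSemantics.
Context {d : Order.disp_t} {L : latticeType d}.
Implicit Types (e : nat -> L).

Definition update e (k : nat) (x : L) : nat -> L := [eta e with k |-> x].

Lemma update_lt e k i x : i < k -> update e k x i = e i.
Proof. by move=> ik; rewrite /update /= ltn_eqF. Qed.

Lemma update_eq e k x : update e k x k = x.
Proof. by rewrite /update /= eqxx. Qed.

Lemma sat_not e phi : sat e (LNot phi) = ~ sat e phi.
Proof. by []. Qed.

Lemma sat_and e phi psi : sat e (LAnd phi psi) = (sat e phi /\ sat e psi).
Proof. by []. Qed.

Lemma sat_or e phi psi : sat e (LOr phi psi) = (sat e phi \/ sat e psi).
Proof. by []. Qed.

Lemma sat_imp e phi psi : sat e (LImp phi psi) = (sat e phi -> sat e psi).
Proof. by []. Qed.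

Lemma sat_all e k phi : sat e (LAll k phi) = forall x, sat (update e k x) phi.
Proof. by []. Qed.

Lemma sat_ex e k phi : sat e (LEx k phi) = exists x, sat (update e k x) phi.
Proof. by []. Qed.

Lemma sat_eq e i j : sat e (f_eq i j) = (e i = e j).
Proof. by []. Qed.

Lemma sat_le e i j : sat e (f_le i j) = (e i <= e j)%O.
Proof. by apply/propext; rewrite /= leEmeet; split=> /eqP. Qed.

Lemma sat_le_join e i j k :
  sat e (f_le_join i j k) = (e i <= Order.join (e j) (e k))%O.
Proof. by apply/propext; rewrite /= leEmeet; split=> /eqP. Qed.

Lemma sat_bottom e k i : i < k -> sat e (f_bottom k i) = is_bottom (e i).
Proof.
move=> ik; rewrite [LHS]sat_all; apply: eq_forall => x.
by rewrite sat_le update_eq update_lt.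
Qed.

Lemma sat_atom e k i : i < k -> sat e (f_atom k i) = is_atom (e i).
Proof.
move=> ik; rewrite [LHS]sat_and sat_not sat_bottom // sat_all.
congr (_ /\ _); apply: eq_forall => x.
by rewrite sat_imp sat_or sat_le sat_bottom // sat_eq update_eq update_lt.
Qed.

Lemma sat_atoms_among e k v a b : v < k -> a < k -> b < k ->
  sat e (f_atoms_among k v a b) = atoms_among (e v) (e a) (e b).
Proof.
move=> vk ak bk; rewrite [LHS]sat_all; apply: eq_forall => x.
by rewrite !sat_imp sat_or sat_atom // sat_le !sat_eq update_eq !update_lt.
Qed.

Lemma sat_isolated e k a : a < k -> sat e (f_isolated k a) = isolated (e a).
Proof.
move=> ak; rewrite [LHS]sat_and sat_atom // sat_all.
congr (_ /\ _); apply: eq_forall => x.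
rewrite sat_imp sat_le sat_atoms_among ?ltnS ?(ltnW ak) //.
by rewrite update_eq update_lt.
Qed.

Lemma sat_thin e k v : v < k -> sat e (f_thin k v) = thin (e v).
Proof.
move=> vk; rewrite [LHS]sat_all; apply: eq_forall => x.
rewrite sat_all; apply: eq_forall => y.
rewrite !sat_imp !sat_le sat_atom // sat_atoms_among ?ltnS ?leqnSn //.
rewrite update_eq !(@update_lt _ k.+1) ?ltnS ?(ltnW vk) // update_eq.
by rewrite update_lt.
Qed.

Lemma sat_linked e k a b : a < k -> b < k ->
  sat e (f_linked k a b) = linked (e a) (e b).
Proof.
move=> ak bk; rewrite [LHS]sat_ex; apply: eq_exists => x.
rewrite !sat_and sat_not sat_atoms_among ?ltnS ?(ltnW ak) ?(ltnW bk) //.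
rewrite sat_thin // sat_le_join update_eq !update_lt //.
by apply/propext; split=> [[? []]|[]].
Qed.

Lemma sat_central e k a : a < k -> sat e (f_central k a) = central (e a).
Proof.
move=> ak; rewrite [LHS]sat_all; apply: eq_forall => x.
rewrite !sat_imp sat_not sat_isolated // sat_linked ?ltnS ?(ltnW ak) //.
by rewrite sat_eq update_eq update_lt.
Qed.

(** Isomorphism invariance of first-order logic, in the case of a monotone
involution. Applied to duality, it carries results about left zero semigroups to
right zero semigroups. *)
Lemma sat_involution (g : L -> L) e phi :
  involutive g -> {homo g : x y / (x <= y)%O} -> sat (g \o e) phi = sat e phi.
Proof.
move=> gK g_homo; have g_le x y : (g x <= y)%O = (x <= g y)%O.
  by apply/idP/idP => /g_homo; rewrite gK.
have gI : {morph g : x y / Order.meet x y}.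
  move=> x y; apply/le_anti/andP; split.
    by rewrite lexI !g_homo ?leIl ?leIr.
  by rewrite -g_le lexI !g_le leIl leIr.
have gU : {morph g : x y / Order.join x y}.
  move=> x y; apply/le_anti/andP; split.
    by rewrite g_le leUx -!g_le leUl leUr.
  by rewrite leUx !g_homo ?leUl ?leUr.
have term e' t : eval_term (g \o e') t = g (eval_term e' t).
  by elim: t => //= t -> u ->; rewrite ?gI ?gU.
have update_comp e' k x : update (g \o e') k (g x) = g \o update e' k x.
  by apply/funext => i; rewrite /update /=; case: eqP.
elim: phi e => [t u|phi IH|phi IH psi JH|phi IH psi JH|phi IH psi JH
  |k phi IH|k phi IH] e.
- by rewrite /= !term; apply/propext; split=> [/(can_inj gK)|->].
- by rewrite !sat_not IH.
- by rewrite !sat_and IH JH.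
- by rewrite !sat_or IH JH.
- by rewrite !sat_imp IH JH.
- rewrite !sat_all; apply/propext; split=> H x.
    by rewrite -IH -update_comp.
  by rewrite -[x]gK update_comp IH.
- rewrite !sat_ex; apply/propext; split=> -[x H].
    by exists (g x); rewrite -IH -update_comp gK.
  by exists (g x); rewrite update_comp IH.
Qed.

End FormulaSemantics.

Lemma isolated_dual (a : SEM) : isolated (dual_variety a : SEM) = isolated a.
Proof.
rewrite -(@sat_isolated _ SEM (fun=> a) 1 0) //.
rewrite -(@sat_involution _ SEM dual_variety) ?sat_isolated //.
  exact: dual_varietyK.
by move=> V W; rewrite -dual_variety_le dual_varietyK.
Qed.

Lemma linked_dual (a b : SEM) :
  linked (dual_variety a : SEM) (dual_variety b) = linked a b.
Proof.
rewrite -(@sat_linked _ SEM (fun i => if i is 0 then a else b) 2 0 1) //.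
rewrite -(@sat_involution _ SEM dual_variety) ?sat_linked //.
  exact: dual_varietyK.
by move=> V W; rewrite -dual_variety_le dual_varietyK.
Qed.

(** * The atoms of the lattice of varieties *)

Inductive atom_kind :=
  LeftZero | RightZero | Semilattice | Null | Cyclic p of prime p.

Definition atom_semigroup k : semigroup :=
  match k with
  | LeftZero => left_zero
  | RightZero => right_zero
  | Semilattice => semilattice2
  | Null => null2
  | Cyclic p _ => cyclic p
  end.

Definition atom k : SEM := var (atom_semigroup k).

Lemma bottomP (V : SEM) :
  is_bottom V <-> forall S, members V S -> forall x y : S, x = y.
Proof.
split=> [Vbot S VS x y|triv W].
  pose W := variety_of [set ((0, [::]), (1, [::]))]%N.
  have /leVP/(_ S VS) := Vbot W.
  by move=> /(_ _ erefl (fun i => if i is 0 then x else y)).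
apply/leVP => S VS; have [Sigma ->] := variety_equational W => i _ f.
exact: triv.
Qed.

Lemma atom_nontrivial k : ~ is_bottom (atom k).
Proof.
move=> /bottomP /(_ _ (var_self (X := _))).
case: k => [||||p pp] /= triv.
1-4: by have := triv true false.
exact: residue0_neq1 pp (triv _ _).
Qed.

(** A variety without these semigroups consists of bands, having neither null nor
cyclic semigroups, and also of nilsemigroups; a nilpotent band is trivial. *)
Lemma exists_atom (V : SEM) :
  ~ is_bottom V -> exists k, members V (atom_semigroup k).
Proof.
move=> nbot; apply: contrapT => nV; apply: nbot; apply/bottomP => S VS.
have nk k : ~ members V (atom_semigroup k) by move=> Vk; apply: nV; exists k.
have nA p : prime p -> ~ members V (cyclic p) by move=> pp; exact: (nk (Cyclic pp)).
have band := (idempotentP V).2 (conj (nk Null) nA) S VS.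
have [|z _ nil] := (nilP V).2 _ S VS.
  by split=> //;
    [exact: (nk Semilattice)|exact: (nk LeftZero)|exact: (nk RightZero)].
suff eqz x : x = z by move=> x y; rewrite (eqz x) (eqz y).
by have [n <-] := nil x; rewrite power_idem //; exact: band.
Qed.

(** Each of the following laws holds in just one of the generating semigroups
(the last one, in one for each prime divisor of its exponent), so that the variety
generated by that semigroup contains no other. *)
Lemma left_zero_kind k :
  (forall x y : atom_semigroup k, x * y = x) -> k = LeftZero.
Proof.
case: k => [||||p pp] //= law.
- by have := law true false.
- by have := law true false.
- by have := law true true.
by case: (residue_absorb pp (law (residue p 0) (residue p 1))).
Qed.

Lemma right_zero_kind k :
  (forall x y : atom_semigroup k, y * x = x) -> k = RightZero.
Proof.
case: k => [||||p pp] //= law.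
- by have := law true false.
- by have := law true false.
- by have := law true true.
have := law (residue p 0) (residue p 1); rewrite residueM => /esym.
by move/(residue0_neq1 pp).
Qed.

Lemma semilattice_kind k :
  (forall x y : atom_semigroup k, x * y = y * x) ->
  (forall x : atom_semigroup k, x * x = x) -> k = Semilattice.
Proof.
case: k => [||||p pp] //= com idem.
- by have := com true false.
- by have := com true false.
- by have := idem true.
by case: (residue_absorb pp (idem (residue p 1))).
Qed.

Lemma null_kind k :
  (forall x y z t : atom_semigroup k, x * y = z * t) -> k = Null.
Proof.
case: k => [||||p pp] //= law.
- by have := law true true false false.
- by have := law true true false false.
- by have := law true true false false.
have := law (residue p 0) (residue p 0) (residue p 0) (residue p 1).
by rewrite !residueM => /(residue0_neq1 pp).
Qed.

Lemma cyclic_left_unit p n : (0 < p)%N ->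
  (forall x y : cyclic p, power x n * y = y) <-> (p %| n.+1)%N.
Proof.
move=> p_gt0; split=> [|pn x y].
  move=> /(_ (residue p 1) (residue p 0)).
  rewrite power_residue residueM muln1 addn0 => /eq_residue -/(_ p_gt0) /eqP.
  by rewrite mod0n.
rewrite (residueE x) (residueE y) power_residue residueM; apply/eq_residue => //.
by rewrite -modnDml -modnMml (eqP pn) mul0n mod0n.
Qed.

Lemma cyclic_commutative p (x y : cyclic p) : x * y = y * x.
Proof. by rewrite (residueE x) (residueE y) !residueM addnC. Qed.

Lemma cyclic_kind k n :
  (forall x y : atom_semigroup k, x * y = y * x) ->
  (forall x y : atom_semigroup k, power x n * y = y) ->
  exists p (pp : prime p), k = Cyclic pp /\ (p %| n.+1)%N.
Proof.
case: k => [||||p pp] /= com unit.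
- by have := com true false.
- by have := com true false.
- by have := unit false true; rewrite power_idem.
- by have := unit true true.
by exists p, pp; split=> //; apply/(cyclic_left_unit _ (prime_gt0 pp)).
Qed.

Section Laws.
Variables (X S : semigroup) (XS : members (var X) S).

Let transfer (u v : word) : (forall f : nat -> X, eval_word f u = eval_word f v) ->
  forall f : nat -> S, eval_word f u = eval_word f v.
Proof. by move=> Xuv; apply: (var_satisfies XS (i := (u, v))). Qed.

Lemma law_left : (forall x y : X, x * y = x) -> forall x y : S, x * y = x.
Proof.
move=> law x y; apply: (@transfer (0, [:: 1])%N (0, [::])%N _ (nth y [:: x])).
by move=> f; apply: law.
Qed.

Lemma law_right : (forall x y : X, y * x = x) -> forall x y : S, y * x = x.
Proof.
move=> law x y; apply: (@transfer (1, [:: 0])%N (0, [::])%N _ (nth y [:: x])).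
by move=> f; apply: law.
Qed.

Lemma law_idempotent : (forall x : X, x * x = x) -> forall x : S, x * x = x.
Proof.
move=> law x; apply: (@transfer (0, [:: 0])%N (0, [::])%N _ (fun=> x)).
by move=> f; apply: law.
Qed.

Lemma law_commutative :
  (forall x y : X, x * y = y * x) -> forall x y : S, x * y = y * x.
Proof.
move=> law x y.
apply: (@transfer (0, [:: 1])%N (1, [:: 0])%N _ (nth y [:: x])).
by move=> f; apply: law.
Qed.

Lemma law_null :
  (forall x y z t : X, x * y = z * t) -> forall x y z t : S, x * y = z * t.
Proof.
move=> law x y z t.
apply: (@transfer (0, [:: 1])%N (2, [:: 3])%N _ (nth t [:: x; y; z])).
by move=> f; apply: law.
Qed.

Lemma law_left_unit n :
  (forall x y : X, power x n * y = y) -> forall x y : S, power x n * y = y.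
Proof.
move=> law x y; have := @transfer (power_word n) (1, [::])%N _ (nth y [:: x]).
by rewrite eval_power_word; apply=> f; rewrite eval_power_word; apply: law.
Qed.

End Laws.

Lemma atom_minimal j k : members (atom j) (atom_semigroup k) -> k = j.
Proof.
case: j => [||||p pp] jk.
- by apply: left_zero_kind; apply: (law_left jk).
- by apply: right_zero_kind; apply: (law_right jk).
- apply: semilattice_kind; first by apply: (law_commutative jk); exact: andbC.
  by apply: (law_idempotent jk); exact: andbb.
- by apply: null_kind; apply: (law_null jk).
have [||q [qq [-> qp]]] := @cyclic_kind k p.-1.
- by apply: (law_commutative jk); exact: cyclic_commutative.
- by apply: (law_left_unit jk); apply/cyclic_left_unit; rewrite ?prednK ?prime_gt0.
move: qp; rewrite prednK ?prime_gt0 // dvdn_prime2 // => /eqP qp.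
by subst q; congr Cyclic; exact: bool_irrelevance.
Qed.

Lemma atom_inj : injective atom.
Proof. by move=> j k jk; apply: atom_minimal; rewrite -jk; exact: var_self. Qed.

Lemma atomP (a : SEM) : is_atom a <-> exists k, a = atom k.
Proof.
split=> [[nbot amin]|[k ->]].
  have [k /var_le ka] := exists_atom nbot; exists k.
  by have [/atom_nontrivial|] := amin _ ka.
split; first exact: atom_nontrivial.
move=> b bk; have [|nbot] := pselect (is_bottom b); first by left.
right; have [j bj] := exists_atom nbot; apply/le_anti; rewrite bk /=.
by rewrite -(atom_minimal ((leVP _ _).1 bk _ bj)); apply/var_le.
Qed.

Lemma atoms_amongP (V : SEM) j k :
  atoms_among V (atom j) (atom k) <->
  forall i, members V (atom_semigroup i) -> i = j \/ i = k.
Proof.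
split=> [Vjk i /var_le iV|Vjk c /atomP[i ->] /var_le /Vjk[]->]; [|by left|by right].
have [|//|/atom_inj ->|/atom_inj ->] := Vjk (atom i); [|by left|by right].
by apply/atomP; exists i.
Qed.

(** * Membership in the varieties generated by the small semigroups *)

Lemma mem_var_left_zero (S : semigroup) :
  (forall x y : S, x * y = x) -> members (var left_zero) S.
Proof.
move=> law [u v] /(_ _ erefl)/= uv f.
have ev w : eval_word f w = f w.1.
  case: w => i s; elim/last_ind: s => // s j IHs.
  by rewrite eval_word_rcons law.
rewrite !ev; congr f; apply/eqP; rewrite eq_sym.
have := uv (fun i => i == u.1); rewrite !eval_left_zero eqxx /=.
by move <-.
Qed.

Lemma mem_var_semilattice (S : semigroup) :
  (forall x y : S, x * y = y * x) -> (forall x : S, x * x = x) ->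
  members (var semilattice2) S.
Proof.
move=> com idem [u v] /(_ _ erefl)/= uv f.
have absorb w i : i \in letters w -> eval_word f w * f i = eval_word f w.
  case: w => j s; elim/last_ind: s => [|s k IHs].
    by rewrite inE => /eqP ->; exact: idem.
  rewrite eval_word_rcons inE mem_rcons inE orbCA => /orP[/eqP ->|js].
    by rewrite -mulgA idem.
  by rewrite -mulgA (com (f k)) mulgA IHs // inE.
have absorbs w w' : satisfies semilattice2 (w, w') ->
    eval_word f w * eval_word f w' = eval_word f w.
  move=> ww'; apply: (eval_word_ind (P := fun z => eval_word f w * z = _)).
    by move=> x y wx wy; rewrite mulgA wx wy.
  have := ww' (fun i => i \in letters w); rewrite !eval_semilattice2.
  move=> E; have /allP w'w : all (mem (letters w)) (letters w').
    by rewrite -[all _ _]E; apply/allP.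
  by move=> i /w'w; exact: absorb.
rewrite -(absorbs u v) // com; apply: absorbs => g; symmetry; exact: uv.
Qed.

Lemma mem_var_null (S : semigroup) :
  (forall x y z t : S, x * y = z * t) -> members (var null2) S.
Proof.
move=> law [[i s] [j t]] /(_ _ erefl)/= st f.
case: s t st => [|k s] [|l t] st.
- have := st (fun l => l == i); rewrite !eval_null2 /= eqxx => /esym/eqP ->.
  by [].
- by have := st (fun=> true); rewrite !eval_null2.
- by have := st (fun=> true); rewrite !eval_null2.
by rewrite !eval_word_cons; exact: law.
Qed.

Lemma mem_join (j k : atom_kind) (S : semigroup) :
  (forall i, satisfies (atom_semigroup j) i -> satisfies (atom_semigroup k) i ->
     satisfies S i) ->
  members (Order.join (atom j) (atom k) : SEM) S.
Proof.
move=> jk; rewrite -[Order.join _ _]/(variety_join _ _) => i [Ji Ki].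
by apply: jk; [apply: Ji|apply: Ki]; exact: var_self.
Qed.

Lemma not_le_join (V : SEM) j k (M : semigroup) i :
  members V M -> satisfies (atom_semigroup j) i ->
  satisfies (atom_semigroup k) i -> ~ satisfies M i ->
  ~ (V <= Order.join (atom j) (atom k))%O.
Proof.
move=> VM ji ki Mi /leVP /(_ M VM) jkM; apply: Mi.
by apply: (join_satisfies jkM) => T /var_satisfies; apply.
Qed.

(** * Isolated atoms *)

(** A variety whose only atom is LZ consists of bands in which e f = e for all
idempotents e and f. *)
Lemma isolated_left_zero : isolated (atom LeftZero).
Proof.
split; first by apply/atomP; exists LeftZero.
move=> V /atoms_amongP VL; apply/leVP => S VS; apply: mem_var_left_zero.
have nSL : ~ members V semilattice2 by move=> /(VL Semilattice)[].
have nRZ : ~ members V right_zero by move=> /(VL RightZero)[].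
have idem := (idempotentP V).2 _ S VS.
have {}idem : idempotent_semigroup S.
  apply: idem; split=> [/(VL Null)[]//|p pp].
  by move=> /(VL (Cyclic pp))[].
by move=> x y; apply: (idempotents_right nSL nRZ VS); apply: idem.
Qed.

Lemma dual_atom_left_zero : dual_variety (atom LeftZero) = atom RightZero.
Proof. exact: dual_var. Qed.

Lemma dual_atom_right_zero : dual_variety (atom RightZero) = atom LeftZero.
Proof. by rewrite -dual_atom_left_zero dual_varietyK. Qed.

Lemma dual_atom_semilattice : dual_variety (atom Semilattice) = atom Semilattice.
Proof. by rewrite dual_var dual_semilattice2. Qed.

Lemma dual_atom_null : dual_variety (atom Null) = atom Null.
Proof. by rewrite dual_var dual_null2. Qed.

Lemma isolated_right_zero : isolated (atom RightZero).
Proof. by rewrite -dual_atom_left_zero isolated_dual; exact: isolated_left_zero. Qed.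

(** In a band, {yx, xyx} is a left zero subsemigroup, so it cannot have two
elements. *)
Lemma band_without_left_zero (V : variety) (S : semigroup) :
  ~ members V left_zero -> members V S -> idempotent_semigroup S ->
  forall x y : S, x * y * x = y * x.
Proof.
move=> nLZ VS idem x y; symmetry.
apply: (excluded_left_zero_pair nLZ VS); try exact: idem.
  by rewrite -2!mulgA (mulgA x x) idem mulgA idem.
by rewrite -!mulgA (mulgA y x (y * x)) idem.
Qed.

(** Without LZ and RZ both yx and xy equal xyx. *)
Lemma isolated_semilattice : isolated (atom Semilattice).
Proof.
split; first by apply/atomP; exists Semilattice.
move=> V /atoms_amongP VL; apply/leVP => S VS.
have nLZ : ~ members V left_zero by move=> /(VL LeftZero)[].
have nRZ : ~ members V right_zero by move=> /(VL RightZero)[].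
have idem : idempotent_semigroup S.
  apply: (idempotentP V).2 VS; split=> [/(VL Null)[]//|p pp].
  by move=> /(VL (Cyclic pp))[].
apply: mem_var_semilattice => // x y.
rewrite -(band_without_left_zero nLZ VS idem x y).
have VdS : members (dual_variety V) (dual S) by rewrite /= dualK.
have /= dual_law : x * (y * x) = x * y.
  exact: (@band_without_left_zero (dual_variety V) (dual S) nRZ VdS idem x y).
by rewrite -mulgA dual_law.
Qed.

(** {a, a * a, 0}, with a = Some true and 0 = None. *)
Definition nil3_op (x y : option bool) : option bool :=
  if (x, y) is (Some true, Some true) then Some false else None.

Fact nil3_opA : associative nil3_op.
Proof. by case=> [[]|] [[]|] [[]|]. Qed.

Definition nil3 : semigroup := MkSemigroup nil3_opA (inhabits None).

(** The law xyz = x'y'z' excludes all atoms but ZM, and holds in [nil3], which is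
not null. *)
Lemma not_isolated_null : ~ isolated (atom Null).
Proof.
move=> [_ isoN].
pose V : SEM := variety_of [set ((0, [:: 1; 2]), (3, [:: 4; 5]))]%N.
have law S : members V S <-> forall x y z x' y' z' : S, x * y * z = x' * y' * z'.
  split=> [VS x y z x' y' z'|law i -> f]; last exact: law.
  exact: (VS _ erefl (nth z' [:: x; y; z; x'; y'])).
have /isoN /leVP /(_ nil3) : atoms_among V (atom Null) (atom Null).
  apply/atoms_amongP => k /law kV; left; case: k kV => [||||p pp] //= kV.
  - by have := kV true true true false true true.
  - by have := kV true true true true true false.
  - by have := kV true true true true true false.
  pose r := residue p 0; have := kV r r r r r (residue p 1).
  by rewrite /r !residueM => /(residue0_neq1 pp).
have VN : members V nil3 by apply/law; do 6! case=> [[]|].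
move=> /(_ VN) /law_null law0.
by have := law0 (fun _ _ _ _ => erefl) (Some true) (Some true) None None.
Qed.

(** The group of order p ^ 2 generates a larger variety with the same atom. *)
Lemma not_isolated_cyclic p (pp : prime p) : ~ isolated (atom (Cyclic pp)).
Proof.
move=> [_ isoA]; have p_gt0 := prime_gt0 pp.
have pp_gt0 : (0 < p * p)%N by rewrite muln_gt0 p_gt0.
pose V : SEM := var (cyclic (p * p)).
have /isoA /var_le pV : atoms_among V (atom (Cyclic pp)) (atom (Cyclic pp)).
  apply/atoms_amongP => k kV; left.
  have [||q [qq [-> qp]]] := @cyclic_kind k (p * p).-1.
  - by apply: (law_commutative kV); exact: cyclic_commutative.
  - by apply: (law_left_unit kV); apply/cyclic_left_unit; rewrite ?prednK.
  move: qp; rewrite prednK // Euclid_dvdM // orbb dvdn_prime2 // => /eqP qp.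
  by subst q; congr Cyclic; exact: bool_irrelevance.
have : (p * p %| p.-1.+1)%N.
  apply/(cyclic_left_unit _ pp_gt0); apply: (law_left_unit pV).
  by apply/cyclic_left_unit; rewrite ?prednK.
rewrite prednK // => /(dvdn_leq p_gt0).
by rewrite leqNgt ltn_Pmull ?prime_gt1.
Qed.

(** * Linked atoms *)

Lemma thin_by_atoms (V : SEM) :
  (forall k, members V (atom_semigroup k) -> isolated (atom k) \/
     forall W : SEM, (W <= V)%O ->
       atoms_among W (atom k) (atom k) -> (W <= atom k)%O) ->
  thin V.
Proof.
move=> Vk W c WV /atomP[k ->{c}] Wk; have [|nbot] := pselect (is_bottom W).
  by apply.
have [j Wj] := exists_atom nbot.
have jk : j = k by case: ((atoms_amongP W k k).1 Wk j Wj).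
subst j; have [[_ iso]|] := Vk k ((leVP _ _).1 WV _ Wj); first exact: iso.
exact.
Qed.

(** The left zero semigroup on two elements with an adjoined identity None. *)
Definition left_zero1_op (x y : option bool) : option bool :=
  if x is Some _ then x else y.

Fact left_zero1_opA : associative left_zero1_op.
Proof. by case=> [?|] [?|] [?|]. Qed.

Definition left_zero1 : semigroup := MkSemigroup left_zero1_opA (inhabits None).

(** Witnessed by the left regular bands, which need not satisfy xyz = xzy. *)
Lemma linked_semilattice_left_zero :
  linked (atom Semilattice) (atom LeftZero).
Proof.
pose V : SEM := variety_of
  [set ((0, [:: 0]), (0, [::])); ((0, [:: 1; 0]), (0, [:: 1]))]%N.
have law S : members V S -> forall x y : S, x * x = x /\ x * y * x = x * y.
  move=> VS x y; split; first exact: (VS _ (or_introl erefl) (fun=> x)).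
  exact: (VS _ (or_intror erefl) (nth y [:: x])).
have Vk k : members V (atom_semigroup k) -> k = Semilattice \/ k = LeftZero.
  move=> /law; case: k => [||||p pp] /= kV; [by right| |by left| |].
  - by have [] := kV true false.
  - by have [] := kV true false.
  by have [/(residue_absorb pp)] := kV (residue p 1) (residue p 1).
exists V; split; first exact/atoms_amongP.
  apply: thin_by_atoms => k /Vk[]->; left; first exact: isolated_semilattice.
  exact: isolated_left_zero.
apply: (@not_le_join _ _ _ left_zero1 ((0, [:: 1; 2]), (0, [:: 2; 1]))%N).
- move=> i [->|->] f; rewrite /eval_word /=; first by case: (f 0%N).
  by case: (f 0%N) => [b|]; case: (f 1%N).
- by move=> f; apply: andbAC.
- by [].
by move=> /(_ (nth (Some false) [:: None; Some true])).
Qed.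

Lemma linked_semilattice_right_zero :
  linked (atom Semilattice) (atom RightZero).
Proof.
rewrite -dual_atom_semilattice -dual_atom_left_zero linked_dual.
exact: linked_semilattice_left_zero.
Qed.

(** A semigroup with xyz = xy in which xy and xz may differ: three left zeros
r = (true, false), (false, true) and (false, false), and a = (true, true), for
which a r = (false, true) while the products a x with x <> r are
(false, false). *)
Definition truncation_op (x y : bool * bool) : bool * bool :=
  if x is (true, true) then (false, if y is (true, false) then true else false)
  else x.

Fact truncation_opA : associative truncation_op.
Proof. by do 3! case=> [[] []]. Qed.

Definition truncation : semigroup :=
  MkSemigroup truncation_opA (inhabits (true, true)).

(** Witnessed by the law xyz = xy, which does not imply xy = xz. *)
Lemma linked_null_left_zero : linked (atom Null) (atom LeftZero).
Proof.
pose V : SEM := variety_of [set ((0, [:: 1; 2]), (0, [:: 1]))]%N.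
have law S : members V S -> forall x y z : S, x * y * z = x * y.
  by move=> VS x y z; exact: (VS _ erefl (nth z [:: x; y])).
have Vk k : members V (atom_semigroup k) -> k = Null \/ k = LeftZero.
  move=> /law; case: k => [||||p pp] /= kV; [by right| | |by left|].
  - by have := kV true true false.
  - by have := kV true true false.
  by case: (residue_absorb pp (kV (residue p 0) (residue p 0) (residue p 1))).
exists V; split; first exact/atoms_amongP.
  apply: thin_by_atoms => k /Vk[]->; last by left; exact: isolated_left_zero.
  right=> W /leVP WV /atoms_amongP WN; apply/leVP => S WS.
  apply: mem_var_null; have [|z zz _] := (nilP W).2 _ S WS.
    split=> [/(WN Semilattice)[]//|/(WN LeftZero)[]//|/(WN RightZero)[]//|p pp].
    by move=> /(WN (Cyclic pp))[].
  suff xy0 x y : x * y = z by move=> x y x' y'; rewrite !xy0.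
  by rewrite -(law S (WV S WS) x y z) (zz _).2.
apply: (@not_le_join _ _ _ truncation ((0, [:: 1]), (0, [:: 2]))%N).
- move=> i -> f; rewrite /eval_word /=.
  by case: (f 0%N) => [[] []]; case: (f 1%N) => [[] []].
- by [].
- by [].
by move=> /(_ (nth (true, false) [:: (true, true); (true, true)])).
Qed.

Lemma linked_null_right_zero : linked (atom Null) (atom RightZero).
Proof.
rewrite -dual_atom_null -dual_atom_left_zero linked_dual.
exact: linked_null_left_zero.
Qed.

(** The semigroup of e = Some true, a = Some false and 0 = None, where e is a
left identity and all other products vanish. *)
Definition left_identity_op (x y : option bool) : option bool :=
  if x is Some true then y else None.

Fact left_identity_opA : associative left_identity_op.
Proof. by case=> [[]|] [[]|] [[]|]. Qed.

Definition left_identity : semigroup :=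
  MkSemigroup left_identity_opA (inhabits None).

(** Witnessed by the laws xy = xxy and xxyy = yyxx, which do not imply
xy = yx. *)
Lemma linked_null_semilattice : linked (atom Null) (atom Semilattice).
Proof.
pose V : SEM := variety_of
  [set ((0, [:: 1]), (0, [:: 0; 1])); ((0, [:: 0; 1; 1]), (1, [:: 1; 0; 0]))]%N.
have law S : members V S -> forall x y : S,
    x * y = x * x * y /\ x * x * y * y = y * y * x * x.
  move=> VS x y; split; first exact: (VS _ (or_introl erefl) (nth y [:: x])).
  exact: (VS _ (or_intror erefl) (nth y [:: x])).
have Vk k : members V (atom_semigroup k) -> k = Null \/ k = Semilattice.
  move=> /law; case: k => [||||p pp] /= kV; [ | |by right|by left|].
  - by have [] := kV true false.
  - by have [] := kV true false.
  have [+ _] := kV (residue p 1) (residue p 0).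
  rewrite !residueM => /esym; rewrite !addn0.
  by rewrite -residueM => /(residue_absorb pp).
exists V; split; first exact/atoms_amongP.
  apply: thin_by_atoms => k /Vk[]->; last by left; exact: isolated_semilattice.
  right=> W /leVP WV /atoms_amongP WN; apply/leVP => S WS.
  apply: mem_var_null; have [|z zz nil] := (nilP W).2 _ S WS.
    split=> [/(WN Semilattice)[]//|/(WN LeftZero)[]//|/(WN RightZero)[]//|p pp].
    by move=> /(WN (Cyclic pp))[].
  suff xy0 x y : x * y = z by move=> x y x' y'; rewrite !xy0.
  have xy n : x * y = power x n * y.
    elim: n => // n IHn; rewrite (law S (WV S WS) x y).1 /=.
    by rewrite -!mulgA IHn.
  by have [n xn] := nil x; rewrite (xy n) xn (zz _).1.
apply: (@not_le_join _ _ _ left_identity ((0, [:: 1]), (1, [:: 0]))%N).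
- move=> i [->|->] f; rewrite /eval_word /=;
  by case: (f 0%N) => [[]|]; case: (f 1%N) => [[]|].
- by [].
- by move=> f; apply: andbC.
by move=> /(_ (nth (Some false) [:: Some true])).
Qed.

Lemma eval_right_zero (f : nat -> right_zero) w : eval_word f w = f (last w.1 w.2).
Proof. by rewrite (@eval_dual left_zero) eval_left_zero. Qed.

(** A variety with no other atoms consists of rectangular bands, where the value
of a word depends only on its first and last letters. *)
Lemma not_linked_left_zero_right_zero :
  ~ linked (atom LeftZero) (atom RightZero).
Proof.
move=> [V [/atoms_amongP VLR _]]; apply; apply/leVP => S VS.
have idem : idempotent_semigroup S.
  apply: (idempotentP V).2 VS; split=> [/(VLR Null)[]//|p pp].
  by move=> /(VLR (Cyclic pp))[].
have nSL : ~ members V semilattice2 by move=> /(VLR Semilattice)[].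
have xyx (x y : S) : x * y * x = x.
  have [||k] := @excluded_semilattice _ _ x (x * y * x) nSL VS (idem x).
  - by rewrite !mulgA idem.
  - by rewrite -mulgA idem.
  by rewrite power_idem //; exact: idem.
have xyz (x y z : S) : x * y * z = x * z.
  by rewrite -{1}(xyx z x) !mulgA -(mulgA x y z) xyx.
apply: mem_join => -[u v] /= uvL uvR f.
have ev w : eval_word f w = f w.1 * f (last w.1 w.2).
  case: w => i s; elim/last_ind: s => [|s j IHs]; first by rewrite /= idem.
  by rewrite eval_word_rcons IHs /= last_rcons xyz.
have uv1 : u.1 = v.1.
  have := uvL (fun i => i == v.1); rewrite !eval_left_zero eqxx /=.
  by move/eqP.
have uv2 : last u.1 u.2 = last v.1 v.2.
  have := uvR (fun i => i == last v.1 v.2); rewrite !eval_right_zero eqxx /=.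
  by move/eqP.
by rewrite !ev uv2 uv1.
Qed.

Fact translate_closed (S : semigroup) (e : S) (x y : {x : S | e * x = x}) :
  e * (sval x * sval y) = sval x * sval y.
Proof. by rewrite mulgA (svalP x). Qed.

Definition translate_mul (S : semigroup) (e : S) (x y : {x : S | e * x = x}) :
    {x : S | e * x = x} :=
  exist _ (sval x * sval y) (translate_closed x y).

Lemma translate_inj (S : semigroup) (e : S) :
  injective (sval : {x : S | e * x = x} -> S).
Proof.
by move=> [x ex] [y ey] /= xy; subst y; congr exist; exact: Prop_irrelevance.
Qed.

Fact translate_mulA (S : semigroup) (e : S) : associative (@translate_mul S e).
Proof. by move=> x y z; apply: translate_inj; exact: mulgA. Qed.

(** The subsemigroup eS, for e idempotent. *)
Definition translate (S : semigroup) (e : S) (ee : e * e = e) : semigroup :=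
  MkSemigroup (@translate_mulA S e) (inhabits (exist _ e ee)).

Lemma sval_translate_power (S : semigroup) (e : S) (ee : e * e = e)
  (x : translate ee) n : sval (power x n) = power (sval x) n.
Proof. by elim: n => //= n ->. Qed.

(** A variety with no other atoms consists of left groups: for each idempotent e
of a member S, eS is a group and x |-> ex a homomorphism from S onto eS. Thinness
puts eS into A_p. An identity valid in LZ has sides with the same first letter
x; if e is the idempotent power of x then the values of both sides belong to eS,
where they are equal if the identity is also valid in A_p. *)
Lemma not_linked_cyclic_left_zero p (pp : prime p) :
  ~ linked (atom (Cyclic pp)) (atom LeftZero).
Proof.
move=> [V [/atoms_amongP VAL thinV]]; apply; apply/leVP => S VS.
have nSL : ~ members V semilattice2 by move=> /(VAL Semilattice)[].
have nRZ : ~ members V right_zero by move=> /(VAL RightZero)[].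
have nN : ~ members V null2 by move=> /(VAL Null)[].
have [n /(_ S VS) perS] := excluded_null nN.
have absorb (x e : S) : e * e = e -> x * e = x.
  have [_ xx idx] := periodic_identity (perS x); move=> ee.
  by rewrite -{1}xx -mulgA (idempotents_right nSL nRZ VS idx ee).
apply: mem_join => -[u v] /= uvA uvL f.
have uv1 : u.1 = v.1.
  have := uvL (fun i => i == v.1); rewrite !eval_left_zero eqxx /=.
  by move/eqP.
have [ef _ ee] := periodic_identity (perS (f u.1)).
set e := power (f u.1) n in ef ee.
pose T := translate ee.
have VT : members V T.
  by apply: (@sub_variety V T S (fun x => sval x) VS) => //; exact: translate_inj.
have unitT (x y : T) : power x n * y = y.
  apply: translate_inj; rewrite /= sval_translate_power.
  have [_ _ idx] := periodic_identity (perS (sval x)).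
  have <- : e = power (sval x) n.
    by rewrite -{1}(absorb e _ idx) power_absorb //; exact: (svalP x).
  exact: (svalP y).
have /leVP /(_ _ (var_self (X := T))) AT : (var T <= atom (Cyclic pp))%O.
  apply: thinV; [exact/var_le|by apply/atomP; exists (Cyclic pp)|].
  apply/atoms_amongP => k Tk; left.
  have [//|kL] := VAL k ((leVP _ _).1 ((var_le _ _).2 VT) _ Tk).
  have := law_left_unit Tk unitT; rewrite kL => /(_ true false).
  by rewrite power_idem.
have eex (x : S) : e * (e * x) = e * x by rewrite mulgA ee.
pose h (x : S) : T := exist _ (e * x) (eex x).
have hM : {morph h : x y / x * y}.
  move=> x y; apply: translate_inj => /=.
  by rewrite !mulgA -(mulgA e x e) (absorb x e ee).
have := var_satisfies AT uvA (h \o f); rewrite !(eval_word_hom _ _ hM).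
move=> /(congr1 sval) /=.
by rewrite !eval_word_absorb // -uv1.
Qed.

(** * Definability *)

Definition is_isolated k :=
  match k with LeftZero | RightZero | Semilattice => true | _ => false end.

Definition is_central k :=
  match k with Semilattice | Null => true | _ => false end.

Lemma isolatedP k : isolated (atom k) <-> is_isolated k.
Proof.
case: k => [||||p pp]; split=> //.
- by move=> _; exact: isolated_left_zero.
- by move=> _; exact: isolated_right_zero.
- by move=> _; exact: isolated_semilattice.
- by move/not_isolated_null.
- by move/not_isolated_cyclic.
Qed.

Lemma isolated_kind (b : SEM) : isolated b -> exists2 k, b = atom k & is_isolated k.
Proof.
move=> isob; have [k bk] := (atomP b).1 isob.1; exists k => //.
by apply/isolatedP; rewrite -bk.
Qed.

Lemma centralP k : central (atom k) <-> is_central k.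
Proof.
case: k => [||||p pp]; split=> //.
- move=> cen; case: not_linked_left_zero_right_zero; apply: cen.
    exact: isolated_right_zero.
  by move/atom_inj.
- move=> cen; case: not_linked_left_zero_right_zero.
  rewrite -linked_dual dual_atom_left_zero dual_atom_right_zero; apply: cen.
    exact: isolated_left_zero.
  by move/atom_inj.
- move=> _ b /isolated_kind[[||||q qq] -> // _] _.
  + exact: linked_semilattice_left_zero.
  + exact: linked_semilattice_right_zero.
- move=> _ b /isolated_kind[[||||q qq] -> // _] _.
  + exact: linked_null_left_zero.
  + exact: linked_null_right_zero.
  + exact: linked_null_semilattice.
move=> cen; case: (@not_linked_cyclic_left_zero p pp); apply: cen.
  exact: isolated_left_zero.
by move/atom_inj.
Qed.

(** The variable 0 stands for the variety and 1 for an atom below it. *)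
Lemma definable_by_atoms (P : semigroup -> Prop) (C : atom_kind -> Prop) phi :
  free_vars (LAll 1 (LImp (f_atom 2 1) (LImp (f_le 1 0) phi))) =i [:: 0%N] ->
  (forall (e : nat -> SEM) k, e 1%N = atom k -> sat e phi <-> C k) ->
  (forall V : variety,
     varieties_of P V <-> forall k, members V (atom_semigroup k) -> C k) ->
  definable (varieties_of P).
Proof.
move=> fv phiC PC; exists (LAll 1 (LImp (f_atom 2 1) (LImp (f_le 1 0) phi))), 0%N.
split=> // e; rewrite sat_all; split=> [He|/PC VC a].
  apply/PC => k /var_le kV.
  have [phiCk _] := phiC (update e 1 (atom k)) k (update_eq e 1 (atom k)).
  apply: phiCk.
  have := He (atom k); rewrite !sat_imp sat_atom // sat_le; apply=> //.
  by apply/atomP; exists k.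
rewrite !sat_imp sat_atom // sat_le => /atomP[k ak] aV.
by apply/(phiC _ k ak)/VC/var_le; rewrite -[X in (X <= _)%O]ak.
Qed.

Theorem theorem2p2 :
  definable (varieties_of completely_regular) /\
  definable (varieties_of completely_simple) /\
  definable (varieties_of periodic_group) /\
  definable (varieties_of combinatorial) /\
  definable (varieties_of idempotent_semigroup) /\
  definable (varieties_of nilsemigroup).
Proof.
pose cen := f_central 2 1; pose iso := f_isolated 2 1.
have cenP (e : nat -> SEM) k : e 1%N = atom k -> sat e cen = is_central k.
  by move=> ek; rewrite sat_central // ek; apply/propext/centralP.
have isoP (e : nat -> SEM) k : e 1%N = atom k -> sat e iso = is_isolated k.
  by move=> ek; rewrite sat_isolated // ek; apply/propext/isolatedP.
have fv phi : all (pred1 0%N) (free_vars phi) -> free_vars phi != [::] ->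
    free_vars phi =i [:: 0%N].
  by move/all_pred1P ->; case: (size _) => // n _ i; rewrite mem_nseq inE.
split; [|split; [|split; [|split; [|split]]]].
- apply: (@definable_by_atoms _ (fun k => ~ (is_central k /\ ~ is_isolated k))
    (LNot (LAnd cen (LNot iso)))); first exact: fv.
    by move=> e k ek; rewrite sat_not sat_and sat_not (cenP e k ek) (isoP e k ek).
  move=> V; rewrite completely_regularP; split=> [nN [||||p pp] Vk []//|VC VN].
  by apply: (VC Null VN).
- apply: (@definable_by_atoms _ (fun k => ~ is_central k) (LNot cen)).
  + exact: fv.
  + by move=> e k ek; rewrite sat_not (cenP e k ek).
  move=> V; rewrite completely_simpleP; split=> [[nN nSL] [||||p pp] Vk //|VC].
  by split=> [/(VC Null)|/(VC Semilattice)]; apply.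
- apply: (@definable_by_atoms _ (fun k => ~ is_central k /\ ~ is_isolated k)
    (LAnd (LNot cen) (LNot iso))); first exact: fv.
    by move=> e k ek; rewrite sat_and !sat_not (cenP e k ek) (isoP e k ek).
  move=> V; rewrite periodic_groupP; split=> [[nN nSL nLZ nRZ] [||||p pp] //|VC].
  by split=> [/(VC Null)[]|/(VC Semilattice)[]|/(VC LeftZero)[]|/(VC RightZero)[]].
- apply: (@definable_by_atoms _ (fun k => is_central k \/ is_isolated k)
    (LOr cen iso)); first exact: fv.
    by move=> e k ek; rewrite sat_or (cenP e k ek) (isoP e k ek).
  move=> V; rewrite combinatorialP; split=> [nA [||||p pp] Vk|VC p pp].
  + by right.
  + by right.
  + by left.
  + by left.
  + by case: (nA p pp).
  by move=> /(VC (Cyclic pp))[].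
- apply: (@definable_by_atoms _ is_isolated iso); first exact: fv.
    by move=> e k ek; rewrite (isoP e k ek).
  move=> V; rewrite idempotentP; split=> [[nN nA] [||||p pp] // /(nA p pp)//|VC].
  by split=> [/(VC Null)//|p pp /(VC (Cyclic pp))].
apply: (@definable_by_atoms _ (fun k => is_central k /\ ~ is_isolated k)
  (LAnd cen (LNot iso))); first exact: fv.
  by move=> e k ek; rewrite sat_and sat_not (cenP e k ek) (isoP e k ek).
move=> V; rewrite nilP; split=> [[nSL nLZ nRZ nA] [||||p pp] //|VC].
  by move=> /(nA p pp).
by split=> [/(VC Semilattice)[]|/(VC LeftZero)[]|/(VC RightZero)[]|
  p pp /(VC (Cyclic pp))[]].
Qed.
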